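(* Let $m,n,r,d$ be integers with $m,n\ge2$, $d\ge1$, $0<r<\min\{m,n\}$; for $0\le a\le rd$ let $d_R=\lfloor a/r\rfloor$, $t_R=a\bmod r$. Let $\mathcal{B}_a$ be the set of products $L(\lambda)R(\lambda)$, $L\in\mathbb{C}[\lambda]^{m\times r}$, $R\in\mathbb{C}[\lambda]^{r\times n}$, with $\deg(R_{i*})=d_R+1$ for $i\le t_R$, $\deg(R_{i*})=d_R$ for $t_R<i\le r$, and $\deg(L_{*i})=d-\deg(R_{i*})$ for all $i$; and let $\mathcal{C}_a$ be the set of products $L(\lambda)R(\lambda)$, $L\in\mathbb{C}[\lambda]^{m\times r}$, $R\in\mathbb{C}[\lambda]^{r\times n}$, with $\deg(R_{i*})\le d_R+1$ and $\deg(L_{*i})\le d-d_R-1$ for $i\le t_R$, and $\deg(R_{i*})\le d_R$ and $\deg(L_{*i})\le d-d_R$ for $t_R<i\le r$. Then: (i) $\mathcal{B}_a\subseteq\mathcal{C}_a$ for $a=0,\dots,rd$; (ii) $\overline{\mathcal{B}_a}=\overline{\mathcal{C}_a}$ for $a=0,\dots,rd$; (iii) $\mathbb{C}[\lambda]^{m\times n}_{d,r}=\bigcup_{0\le a\le rd}\overline{\mathcal{C}_a}$; (iv) for every $P(\lambda)\in\mathbb{C}[\lambda]^{m\times n}_{d,r}$ there exists an integer $a$ with $P(\lambda)\in\overline{\mathcal{C}_a}$.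
   Context: $\mathbb{C}[\lambda]^{m\times n}_{d,r}$: complex $m\times n$ polynomial matrices of degree at most $d$ and normal rank (rank over $\mathbb{C}(\lambda)$) at most $r$. Degree of a polynomial vector: maximum degree of entries, $\deg0=-\infty$. $L_{*i}$: $i$th column; $R_{i*}$: $i$th row. Closures are in $\mathbb{C}[\lambda]^{m\times n}_d$ with metric $\mathrm{dist}(P,Q)=(\sum_{i=0}^d\|P_i-Q_i\|_F^2)^{1/2}$, $P_i,Q_i$ the coefficients of $\lambda^i$. *)

(* Defs.v *)
(* The complex field C is modelled as R[i] (mathcomp-real-closed
   complex) over an arbitrary realType R (every realType is a model of the reals). *)
From HB Require Import structures.
From mathcomp Require Import all_boot all_order all_algebra.
From mathcomp Require Import fraction reals.
From mathcomp Require Import complex.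
Set Implicit Arguments. Unset Strict Implicit. Unset Printing Implicit Defensive.
Import Order.TTheory GRing.Theory Num.Theory.
Local Open Scope ring_scope.

Section Defs.
Variable R : realType.
Local Notation C := (R[i]).

(* size of a polynomial vector = (degree + 1), with size 0 = 0 (degree -oo) *)
Definition row_size (r n : nat) (M : 'M[{poly C}]_(r, n)) (i : 'I_r) : nat :=
  \max_(j < n) size (M i j).
Definition col_size (m r : nat) (M : 'M[{poly C}]_(m, r)) (i : 'I_r) : nat :=
  \max_(k < m) size (M k i).

Definition deg_le (m n d : nat) (P : 'M[{poly C}]_(m, n)) : Prop :=
  forall i j, (size (P i j) <= d.+1)%N.

Definition normal_rank (m n : nat) (P : 'M[{poly C}]_(m, n)) : nat :=
  \rank (map_mx (fun p : {poly C} => (@FracField.tofrac {poly C} p : {fraction {poly C}})) P).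

Definition Cdr (m n d r : nat) : 'M[{poly C}]_(m, n) -> Prop :=
  fun P => deg_le d P /\ (normal_rank P <= r)%N.

Definition sqmod (z : C) : R := complex.Re z ^+ 2 + complex.Im z ^+ 2.

Definition pdist (m n d : nat) (P Q : 'M[{poly C}]_(m, n)) : R :=
  Num.sqrt (\sum_(k < d.+1) \sum_(i < m) \sum_(j < n)
              sqmod ((P i j)`_k - (Q i j)`_k)).

Definition pclosure (m n d : nat) (S : 'M[{poly C}]_(m, n) -> Prop) :
    'M[{poly C}]_(m, n) -> Prop :=
  fun P => deg_le d P /\
    forall eps : R, 0 < eps -> exists Q, S Q /\ pdist d P Q < eps.

(* d_R = a / r, t_R = a mod r ; row indices are 0-based, so "i <= t_R" is "i < t_R" *)
Definition Bset (m n r d a : nat) : 'M[{poly C}]_(m, n) -> Prop :=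
  fun P => exists (L : 'M[{poly C}]_(m, r)) (Rm : 'M[{poly C}]_(r, n)),
    P = L *m Rm /\
    forall i : 'I_r,
      if (i < a %% r)%N then
        row_size Rm i = (a %/ r).+2 /\
        (* deg L_{*i} = d - deg R_{i*} = d - d_R - 1 *)
        col_size L i = (d - (a %/ r))%N
      else
        row_size Rm i = (a %/ r).+1 /\
        col_size L i = (d - (a %/ r)).+1.

Definition Cset (m n r d a : nat) : 'M[{poly C}]_(m, n) -> Prop :=
  fun P => exists (L : 'M[{poly C}]_(m, r)) (Rm : 'M[{poly C}]_(r, n)),
    P = L *m Rm /\
    forall i : 'I_r,
      if (i < a %% r)%N then
        (row_size Rm i <= (a %/ r).+2)%N /\ (col_size L i <= d - (a %/ r))%N
      else
        (row_size Rm i <= (a %/ r).+1)%N /\ (col_size L i <= (d - (a %/ r)).+1)%N.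

End Defs.

Arguments Bset : clear implicits.
Arguments Cset : clear implicits.
Arguments pclosure : clear implicits.
Arguments Cdr : clear implicits.

(* Main.v *)
Require Import Defs.
From HB Require Import structures.
From mathcomp Require Import all_boot all_order all_algebra.
From mathcomp Require Import fraction reals complex.
From mathcomp Require Import generic_quotient ring lra zify.
Set Implicit Arguments. Unset Strict Implicit. Unset Printing Implicit Defensive.
Import Order.TTheory GRing.Theory Num.Theory.
Local Open Scope ring_scope.

(** A matrix of normal rank at most [r] is a product of polynomial matrices of inner
    dimension [r]: clear denominators in a rank factorization over the fraction field,
    then cancel the common denominator one linear factor at a time.  As long as some
    column degree plus row degree exceeds [d], the vanishing of the corresponding
    coefficient of the product gives a linear relation between leading coefficients of
    rows, and a row operation lowers a row degree.  This ends with degrees bounded by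
    [e i] for the rows and [d - e i] for the columns.  If [e i1 < e i2], the product is
    a limit of products in which one unit of row degree has moved from [i2] to [i1];
    iterating, it lies in the closure of the products whose row degrees are the balanced
    ones.  Perturbing top coefficients makes the degrees exact.  Conversely, a matrix
    [P] of normal rank above [r] satisfies [U P(x) V = 1] of size [r.+1] at some point
    [x], and [U Q(x) V] remains invertible for [Q] near [P]. *)

(** * Rank factorization over the fraction field, with denominators cleared *)

Section FractionMatrices.
Variable D : idomainType.
Local Notation tofrac := (@FracField.tofrac D).

Lemma frac_clear_denominator (x : {fraction D}) :
  exists c a : D, c != 0 /\ tofrac c * x = tofrac a.
Proof.
elim/quotW: x => -[[a b] b0]; exists b, a; split=> //.
apply/eqP; rewrite -[X in X == _]/(FracField.mul _ _) !piE.
rewrite /FracField.equivf /FracField.mulf.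
by rewrite !numden_Ratio ?oner_eq0 ?mul1r ?mulr1 //= mulrC.
Qed.

Lemma mx_clear_denominators m n (M : 'M[{fraction D}]_(m, n)) :
  exists2 c : D, c != 0 & exists A : 'M[D]_(m, n),
    tofrac c *: M = map_mx tofrac A.
Proof.
have [c cP] := fin_all_exists (fun ij : 'I_m * 'I_n =>
  frac_clear_denominator (M ij.1 ij.2)).
have [a aP] := fin_all_exists cP.
exists (\prod_ij c ij).
  by apply/prodf_neq0 => ij _; case: (aP ij).
exists (\matrix_(i, j) (a (i, j) * \prod_(ij | ij != (i, j)) c ij)).
apply/matrixP=> i j; rewrite !mxE (bigD1 (i, j)) //=.
by rewrite !tofracM; case: (aP (i, j)) => _ <-; rewrite mulrAC.
Qed.

Lemma normal_rank_factor m n r (P : 'M[D]_(m, n)) :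
  (\rank (map_mx tofrac P) <= r)%N ->
  exists2 c : D, c != 0 &
    exists (L : 'M_(m, r)) (Rm : 'M_(r, n)), c *: P = L *m Rm.
Proof.
set M := map_mx _ P => Mr.
(* Zero padding by [pid_mx] makes the inner dimension exactly [r], which is possible because
   [\rank M <= r]. *)
have eM : M = (col_ebase M *m pid_mx (\rank M)) *m
              ((pid_mx (\rank M) : 'M_(r, n)) *m row_ebase M).
  rewrite mulmxA -(mulmxA (col_ebase M)) mul_pid_mx minnn (minn_idPr Mr).
  by rewrite mulmx_ebase.
have [c c0 [L eL]] := mx_clear_denominators (col_ebase M *m pid_mx (\rank M) : 'M_(m, r)).
have [b b0 [B eB]] := mx_clear_denominators ((pid_mx (\rank M) : 'M_(r, n)) *m row_ebase M).
exists (c * b); first by rewrite mulf_neq0.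
exists L, B.
suff: map_mx tofrac ((c * b) *: P) = map_mx tofrac (L *m B).
  move/matrixP=> e; apply/matrixP=> i j; apply/eqP.
  by rewrite -tofrac_eq; move: (e i j); rewrite !mxE => ->.
rewrite map_mxZ map_mxM /= -eL -eB -/M {1}eM tofracM.
by rewrite -scalemxAl -scalemxAr scalerA.
Qed.

End FractionMatrices.

(** * Cancelling the common denominator *)

Section LinearFactorCancellation.
Variable F : fieldType.

Lemma map_horner_factor m n (A : 'M[{poly F}]_(m, n)) x :
  map_mx (horner^~ x) A = 0 -> exists B, A = ('X - x%:P) *: B.
Proof.
move=> A0; exists (map_mx (fun p => p %/ ('X - x%:P)) A).
apply/matrixP=> i j; rewrite !mxE mulrC divpK // dvdp_XsubCl.
by apply/eqP; move/matrixP/(_ i j): A0; rewrite !mxE.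
Qed.

(* After a constant change of basis bringing [B(x)] to echelon form, [A(x) B(x) = 0] says
   that ['X - x] divides the first [\rank B(x)] columns of [A] and the other rows of [B]. *)
Lemma cancel_linear_factor m r n (P : 'M[{poly F}]_(m, n))
    (A : 'M_(m, r)) (B : 'M_(r, n)) x :
  ('X - x%:P) *: P = A *m B ->
  exists (A' : 'M_(m, r)) (B' : 'M_(r, n)), P = A' *m B'.
Proof.
move=> e; set Bx := map_mx (horner^~ x) B; pose s : nat := \rank Bx.
pose U := map_mx polyC (col_ebase Bx); pose V := map_mx polyC (invmx (col_ebase Bx)).
have UV : U *m V = 1%:M.
  by rewrite -map_mxM mulmxV ?col_ebase_unit // map_mx1.
have evC k l (M : 'M[F]_(k, l)) : map_mx (horner^~ x) (map_mx polyC M) = M.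
  by apply/matrixP=> i j; rewrite !mxE hornerC.
have evM k l q (M : 'M_(k, l)) (N : 'M_(l, q)) : map_mx (horner^~ x) (M *m N) =
    map_mx (horner^~ x) M *m map_mx (horner^~ x) N.
  exact: (map_mxM (horner_eval x)).
have VB : map_mx (horner^~ x) (V *m B) = pid_mx s *m row_ebase Bx.
  rewrite evM evC -/Bx -[X in _ *m X](mulmx_ebase Bx) !mulmxA mulVmx ?mul1mx //.
  exact: col_ebase_unit.
have sr : (s <= r)%N by exact: rank_leq_row.
have AUVB : (A *m U) *m (V *m B) = ('X - x%:P) *: P.
  by rewrite mulmxA -(mulmxA A) UV mulmx1.
(* The product vanishes at [x], where its right factor is [pid_mx s *m row_ebase Bx]; undoing the
   invertible [row_ebase Bx] shows that the first [s] columns of [A *m U] vanish at [x]. *)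
have AU : map_mx (horner^~ x) (A *m U *m pid_mx s) = 0 :> 'M_(m, r).
  have : map_mx (horner^~ x) (A *m U) *m (pid_mx s *m row_ebase Bx) = 0.
    rewrite -VB -evM AUVB; apply/matrixP=> i j.
    by rewrite !mxE hornerM hornerXsubC subrr mul0r.
  move/(congr1 (mulmx^~ (invmx (row_ebase Bx)))).
  rewrite !mulmxA mulmxK ?row_ebase_unit // mul0mx.
  move/(congr1 (mulmx^~ (pid_mx s : 'M_(n, r)))).
  rewrite -(mulmxA _ (pid_mx s : 'M_(r, n))) mul_pid_mx mul0mx.
  rewrite minnn (minn_idPr (rank_leq_col Bx)) => <-.
  by rewrite evM -(map_pid_mx polyC) evC.
have CB : map_mx (horner^~ x) (copid_mx s *m (V *m B)) = 0 :> 'M_(r, n).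
  rewrite evM VB (_ : map_mx _ _ = copid_mx s).
    by rewrite mulmxA mul_copid_mx_pid // mul0mx.
  by rewrite -(evC _ _ (copid_mx s)) map_copid_mx.
have [A1 eA1] := map_horner_factor AU; have [B1 eB1] := map_horner_factor CB.
(* Each of the [r] column-times-row terms of [(A *m U) *m (V *m B)] loses one linear factor: from
   the column in the first [s] terms, from the row in the others. *)
exists (A1 + A *m U *m copid_mx s), (pid_mx s *m (V *m B) + B1).
have X0 : 'X - x%:P != 0 by rewrite polyXsubC_eq0.
suff : ('X - x%:P) ^+ 2 *: P = ('X - x%:P) ^+ 2 *:
    ((A1 + A *m U *m copid_mx s) *m (pid_mx s *m (V *m B) + B1)).
  move/matrixP => E; apply/matrixP=> i j; apply: (mulfI (expf_neq0 2 X0)).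
  by move: (E i j); rewrite !mxE.
rewrite expr2 -!scalerA scalemxAr scalemxAl !scalerDr -eA1 -eB1 -AUVB.
have pc : pid_mx s *m copid_mx s = 0 :> 'M[{poly F}]_r by rewrite mul_pid_mx_copid.
have cp : copid_mx s *m pid_mx s = 0 :> 'M[{poly F}]_r by rewrite mul_copid_mx_pid.
have pp : pid_mx s *m (pid_mx s : 'M_r) = pid_mx s :> 'M[{poly F}]_r by rewrite pid_mx_id.
have cc : copid_mx s *m copid_mx s = copid_mx s :> 'M[{poly F}]_r by rewrite copid_mx_id.
have psc : pid_mx s + copid_mx s = 1%:M :> 'M[{poly F}]_r by rewrite subrKC.
move: (A *m U) (V *m B) (copid_mx s) (pid_mx s : 'M_r) pc cp pp cc psc.
move=> A' B' c p pc cp pp cc psc; rewrite mulmxDl !mulmxDr -!scalemxAl -!scalemxAr !mulmxA.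
rewrite -!(mulmxA A') pc cp pp cc !mul0mx mulmx0 !scaler0 addr0 add0r.
by rewrite -scalerDr -mulmxDr -mulmxDl psc mul1mx.
Qed.

End LinearFactorCancellation.

Lemma cancel_factor (F : closedFieldType) m r n (P : 'M[{poly F}]_(m, n)) c
    (A : 'M_(m, r)) (B : 'M_(r, n)) :
  c != 0 -> c *: P = A *m B ->
  exists (A' : 'M_(m, r)) (B' : 'M_(r, n)), P = A' *m B'.
Proof.
have [k] := ubnP (size c); elim: k => // k IH in c A B *; rewrite ltnS => ck c0 e.
have [/eqP c1|c1] := eqVneq (size c) 1.
  have [a a0 ea] := size_poly1P _ c1; exists (a^-1%:P *: A), B.
  rewrite -scalemxAl -e ea scalerA -polyCM mulVf // scale1r //.
have /closed_rootP [x /factor_theorem [q eq]] := c1.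
have q0 : q != 0 by apply: contraNneq c0 => q0; rewrite eq q0 mul0r.
move: e; rewrite eq mulrC -scalerA => /cancel_linear_factor [A' [B' e']].
apply: IH e' => //; move: ck; rewrite eq size_Mmonic ?monicXsubC //.
by rewrite size_XsubC addn2.
Qed.

(** * Row operations leading to a degree profile *)

Section DegreeProfile.
Variable F : fieldType.

Definition profile_factor m n r d (e : 'I_r -> nat) (P : 'M[{poly F}]_(m, n)) :=
  exists (L : 'M_(m, r)) (Rm : 'M_(r, n)), P = L *m Rm /\
    forall i, (forall j, (size (Rm i j) <= (e i).+1)%N) /\
              (forall k, (size (L k i) <= (d - e i).+1)%N).

Lemma coefM_top (p q : {poly F}) a b :
  (size p <= a.+1)%N -> (size q <= b.+1)%N -> (p * q)`_(a + b) = p`_a * q`_b.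
Proof.
move=> sp sq; rewrite coefM.
rewrite (bigD1 (inord a)) //= inordK ?ltnS ?leq_addr // addKn.
rewrite big1 ?addr0 // => i ia.
have : (i : nat) != a.
  by apply: contra ia => /eqP ia; apply/eqP/val_inj; rewrite /= inordK ?ltnS ?leq_addr.
rewrite neq_ltn => /orP[ia'|ai]; last by rewrite (nth_default _ (leq_trans sp ai)) mul0r.
rewrite [q`__]nth_default ?mulr0 //; apply: leq_trans sq _; lia.
Qed.

(** Since [u *m w = 0], the matrices [1 - w u] and [1 + w u] are inverse to each other, and they are
    inserted between the two factors. *)
Lemma add_row_combination m r n (L : 'M[{poly F}]_(m, r)) (Rm : 'M_(r, n))
    (w : 'cV_r) (u : 'rV_r) :
  u *m w = 0 ->
  (L - L *m w *m u) *m (Rm + w *m u *m Rm) = L *m Rm.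
Proof.
move=> uw; rewrite -{1}[Rm]mul1mx -mulmxDl mulmxA mulmxBl !mulmxDr !mulmx1.
rewrite !mulmxA -(mulmxA _ u w) uw mulmx0 mul0mx addr0.
by rewrite addrK.
Qed.

(** Induction on the sum of size bounds [s i] for the rows of [Rm]. The bounds need not be attained;
    each row operation lowers one of them by one. *)
Lemma exists_degree_profile m r n d (P : 'M[{poly F}]_(m, n))
    (L : 'M_(m, r)) (Rm : 'M_(r, n)) :
  P = L *m Rm -> (forall i j, (size (P i j) <= d.+1)%N) ->
  exists e : 'I_r -> nat, (forall i, (e i <= d)%N) /\ profile_factor d e P.
Proof.
move=> eP dP.
have [s sP] : exists s : 'I_r -> nat, forall i j, (size (Rm i j) <= s i)%N.
  by exists (fun i => \max_j size (Rm i j))%N => i j; exact: leq_bigmax.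
have [N] := ubnP (\sum_i s i)%N.
elim: N => // N IH in s L Rm sP eP *; rewrite ltnS => sN.
(* Sizes are degrees plus one, so the bound [d.+2] on a sum of two sizes is the bound [d] on the sum
   of the degrees. *)
pose ok (ki : 'I_m * 'I_r) :=
  [|| s ki.2 == 0, L ki.1 ki.2 == 0%R | s ki.2 + size (L ki.1 ki.2) <= d.+2]%N.
case: (pickP (predC ok)) => [[k i]|/(_ (_, _))/negbFE okP]; last first.
  (* An index that is not live contributes nothing to the product, but one of its two factors may
     still have large degree. Both are replaced by zero. *)
  pose live i := [exists k, L k i != 0] && (0 < s i)%N.
  have dead i : ~~ live i -> (forall k, L k i = 0) \/ (forall j, Rm i j = 0).
    rewrite negb_and -leqNgt leqn0 => /orP[/existsPn h|/eqP s0].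
      by left=> k; apply/eqP; rewrite -[_ == _]negbK h.
    by right=> j; apply/eqP; rewrite -size_poly_leq0 -s0.
  exists (fun i => if live i then (s i).-1 else 0%N); split=> [i|].
    case: ifP => // /andP[/existsP[k Lk] s0].
    move: (okP k i); rewrite /ok /= (negPf Lk) eqn0Ngt s0 /=.
    move: Lk; rewrite -size_poly_gt0; move: (size _) => q; lia.
  exists (\matrix_(k, i) if live i then L k i else 0).
  exists (\matrix_(i, j) if live i then Rm i j else 0); split=> [|i].
    rewrite eP; apply/matrixP=> k j; rewrite !mxE; apply: eq_bigr => i _.
    rewrite !mxE; case: ifPn => // /dead[] -> ; rewrite ?mulr0 ?mul0r //.
  split=> [j|k]; rewrite !mxE; case: (boolP (live i)) => [/andP[_ s0]|_];
    rewrite ?size_poly0 ?prednK //.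
  move: (okP k i); rewrite /ok eqn0Ngt s0 /= => /orP[/eqP ->|].
    by rewrite size_poly0.
  by move: (size _) => q; lia.
rewrite /= !negb_or -ltnNge -lt0n => /and3P[si Li bad].
pose A i := (0 < s i)%N && (L k i != 0).
have Ai : A i by rewrite /A si.
have [i1 Ai1 i1max] := arg_maxnP (fun i => s i + size (L k i))%N Ai.
set M := (s i1 + size (L k i1))%N in i1max.
have dM : (d.+2 < M)%N by apply: leq_trans bad (i1max i Ai).
(* [c i] is the coefficient that meets the one of degree [(s i).-1] of row [i] in total degree
   [M.-2]. The guard ensures that [s i] is positive wherever [c i != 0], and that no subtraction is
   truncated. *)
pose c i := if (0 < s i < M)%N then (L k i)`_(M.-1 - s i) else 0.
(* The coefficient of degree [M.-2 > d] in row [k] of [P]. *)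
have rel j : \sum_i c i * (Rm i j)`_(s i).-1 = 0.
  have : (P k j)`_(M.-2) = 0 by rewrite nth_default //; apply: leq_trans (dP k j) _; lia.
  rewrite eP mxE coef_sum => PkE; rewrite -[RHS]PkE; apply: eq_bigr => t _; rewrite /c.
  have [st0|st] := posnP (s t).
    by have := sP t j; rewrite st0 size_poly_leq0 => /eqP ->; rewrite mulr0 !coef0 mulr0.
  have [->|Lt] := eqVneq (L k t) 0; first by rewrite mul0r !coef0 if_same mul0r.
  have le : (s t + size (L k t) <= M)%N by apply: i1max; rewrite /A st Lt.
  have gt0 : (0 < size (L k t))%N by rewrite size_poly_gt0.
  have stM : (s t < M)%N by apply: leq_trans le; rewrite -addn1 leq_add2l.
  rewrite stM /=.
  rewrite (_ : M.-2 = (M.-1 - s t) + (s t).-1)%N; last by lia.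
  rewrite coefM_top // ?prednK //; move: le; move: (size _) => q; lia.
have c1 : c i1 != 0.
  case/andP: Ai1 => s1 L1; rewrite -size_poly_gt0 in L1.
  rewrite /c s1 /= (_ : (s i1 < M)%N) /=; last by rewrite /M -addn1 leq_add2l.
  rewrite (_ : (M.-1 - s i1 = (size (L k i1)).-1)%N); last by rewrite /M; move: (size _) => q; lia.
  by rewrite -lead_coefE lead_coef_eq0 -size_poly_gt0.
(* Maximality of [s i0] makes [s i0 - s t] a true difference wherever [c t != 0]. Adding to row [i0]
   the other rows, shifted by these powers and weighted by [c t / c i0], turns its top coefficient
   into a multiple of [rel]. *)
have [i0 c0 i0max] := arg_maxnP s (c1 : (fun i => c i != 0) i1).
have s0 : (0 < s i0)%N by move: c0; rewrite /c; case: (posnP (s i0)) => // ->; rewrite eqxx.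
pose u : 'rV[{poly F}]_r := \row_t if t == i0 then 0 else (c t / c i0)%:P * 'X^(s i0 - s t).
pose w : 'cV[{poly F}]_r := delta_mx i0 0.
have uw : u *m w = 0.
  apply/matrixP=> a b; rewrite !mxE big1 // => t _; rewrite !mxE.
  by case: eqP => [|]; rewrite ?mul0r ?mulr0.
have eP' : P = (L - L *m w *m u) *m (Rm + w *m u *m Rm).
  by rewrite add_row_combination.
pose s' t := if t == i0 then (s t).-1 else s t.
apply: (IH s' _ _ _ eP') => [t j|]; last first.
  apply: leq_trans sN.
  rewrite (bigD1 i0) //= [in X in (_ < X)%N](bigD1 i0) //= /s' eqxx.
  rewrite (eq_bigr s) => [|t /negPf -> //]; lia.
rewrite mxE -mulmxA [(w *m _) t j]mxE big_ord1 mxE eqxx andbT /s'.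
have [->|ti] := eqVneq t i0; last by rewrite mul0r addr0.
rewrite mul1r mxE; apply/leq_sizeP => a ha.
have -> : a = ((s i0).-1 + (a - (s i0).-1))%N by lia.
move: (a - _)%N => b; apply: (mulfI c0); rewrite mulr0.
(* For [b = 0] these terms sum to zero by [rel]; for [b > 0] each of them lies beyond the size bound
   of its row. *)
have key t' : c i0 * (u 0 t' * Rm t' j + (if t' == i0 then Rm i0 j else 0))`_((s i0).-1 + b)
     = c t' * (Rm t' j)`_((s t').-1 + b).
  rewrite mxE; have [->|ti] := eqVneq t' i0; first by rewrite mul0r add0r.
  rewrite addr0; have [->|ct] := eqVneq (c t') 0.
    by rewrite !mul0r coef0 mulr0.
  have le := i0max _ ct.
  have st : (0 < s t')%N by move: ct; rewrite /c; case: (posnP (s t')) => // ->; rewrite eqxx.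
  rewrite -mulrA coefCM mulrA mulrCA mulfV // mulr1 coefXnM.
  rewrite (_ : (_ < _)%N = false); last by move: le => /=; lia.
  by congr (_ * _`__); move: le => /=; lia.
rewrite addrC -[X in (_ + X)](_ : \sum_t' (if t' == i0 then Rm i0 j else 0) = _).
  rewrite -big_split coef_sum mulr_sumr (eq_bigr _ (fun t' _ => key t')).
  have [->|b0] := posnP b; first by rewrite -[RHS](rel j); apply: eq_bigr => ? _; rewrite addn0.
  rewrite big1 // => t' _; rewrite nth_default ?mulr0 //.
  by apply: leq_trans (sP t' j) _; lia.
by rewrite -big_mkcond big_pred1_eq.
Qed.

End DegreeProfile.

(** * Moving one unit of degree between two rows *)

Section ProfileShift.
Variable F : fieldType.
Implicit Types m n r d : nat.

Lemma profile_factor_size m n r d (e : 'I_r -> nat) (P : 'M[{poly F}]_(m, n)) :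
  (forall i, (e i <= d)%N) -> profile_factor d e P ->
  forall i j, (size (P i j) <= d.+1)%N.
Proof.
move=> ed [L [Rm [-> LR]]] k j; rewrite mxE; apply: leq_trans (size_sum _ _ _) _.
apply/bigmax_leqP => i _; apply: leq_trans (size_polyMleq _ _) _.
have [/(_ j) Rij /(_ k) Lki] := LR i; move: (ed i) Rij Lki.
by move: (size (Rm i j)) (size (L k i)) => a b; lia.
Qed.

Lemma profile_factor_eq m n r d (e e' : 'I_r -> nat) (P : 'M[{poly F}]_(m, n)) :
  e =1 e' -> profile_factor d e P -> profile_factor d e' P.
Proof. by move=> ee' [L [Rm [eP LR]]]; exists L, Rm; split=> // i; rewrite -ee'. Qed.

Lemma size_cancel_top (p : {poly F}) a : (size p <= a.+1)%N -> p`_a = 0 -> (size p <= a)%N.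
Proof.
move=> sp pa; apply/leq_sizeP => j; rewrite leq_eqVlt => /orP[/eqP <- //|ja].
exact: nth_default (leq_trans sp ja).
Qed.

Lemma size_polyCM_Xn (c : F) k a : (k <= a)%N -> (size (c%:P * 'X^k)%R <= a.+1)%N.
Proof.
move=> ka; rewrite mul_polyC; apply: leq_trans (size_scale_leq _ _) _.
by rewrite size_polyXn.
Qed.

(* One unit of row degree is moved from [i2] to [i1].  For [dl != 0] the new
   [i1]-row acquires [dl] times the top coefficient of the [i2]-row, which is then
   used to cancel that top coefficient, symmetrically for the columns of [L]. *)
Lemma profile_shift m n r d (e : 'I_r -> nat) (P : 'M[{poly F}]_(m, n)) i1 i2 :
  (e i1 < e i2 <= d)%N -> profile_factor d e P ->
  exists Z : 'M[{poly F}]_(m, n), forall dl : F, dl != 0 ->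
    profile_factor d (fun i => if i == i1 then (e i1).+1
                               else if i == i2 then (e i2).-1 else e i)
      (P + dl%:P *: Z).
Proof.
case/andP=> e12 e2d [L [Rm [eP LR]]].
have i12 : i2 != i1 by apply: contraTneq e12 => ->; rewrite ltnn.
pose v j := ((Rm i2 j)`_(e i2))%:P; pose w k := ((L k i1)`_(d - e i1))%:P.
exists (\matrix_(k, j) (L k i1 * 'X^((e i1).+1) * v j - w k * 'X^((d - e i2).+1) * Rm i2 j)).
move=> dl dl0; set e' := fun i => _.
(* The terms in [Y] cancel: [(L1 + Y l2) r1 + l2 (R2 - Y r1) = L1 r1 + l2 R2]. The product is
   therefore affine in [dl] with slope [Z], although its factors contain [dl^-1]. The exponent lifts
   degree [e i1 + 1] to [e i2], and [d - e i2 + 1] to [d - e i1]. *)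
pose Y := (dl^-1)%:P * 'X^(e i2 - (e i1).+1) : {poly F}.
pose r1 j := Rm i1 j + dl%:P * 'X^((e i1).+1) * v j.
pose l2 k := L k i2 - dl%:P * 'X^((d - e i2).+1) * w k.
exists (\matrix_(k, i) if i == i1 then L k i1 + Y * l2 k else if i == i2 then l2 k else L k i).
exists (\matrix_(i, j) if i == i1 then r1 j else if i == i2 then Rm i2 j - Y * r1 j else Rm i j).
split.
  apply/matrixP=> k j; rewrite !mxE eP mxE.
  rewrite (bigD1 i1) // (bigD1 i2) //= [in RHS](bigD1 i1) // [in RHS](bigD1 i2) //=.
  rewrite !mxE eqxx (negPf i12) eqxx.
  rewrite [in RHS](eq_bigr (fun i => L k i * Rm i j)); last first.
    by move=> i /andP[/negPf h1 /negPf h2]; rewrite !mxE h1 h2.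
  rewrite /l2 /r1; ring.
have r1s j : (size (r1 j) <= (e i1).+2)%N.
  apply: leq_trans (size_polyD _ _) _; rewrite geq_max; apply/andP; split.
    by apply: leqW; case: (LR i1) => /(_ j).
  by rewrite mulrAC -polyCM size_polyCM_Xn.
have l2s k : (size (l2 k) <= (d - e i2).+2)%N.
  apply: leq_trans (size_polyD _ _) _; rewrite geq_max size_polyN; apply/andP; split.
    by apply: leqW; case: (LR i2) => _ /(_ k).
  by rewrite mulrAC -polyCM size_polyCM_Xn.
have Ys b (p : {poly F}) : (size p <= b.+1)%N -> (size (Y * p)%R <= (e i2 - (e i1).+1 + b).+1)%N.
  move=> sp; rewrite /Y -mulrA mul_polyC; apply: leq_trans (size_scale_leq _ _) _.
  by apply: leq_trans (size_polyMleq _ _) _; rewrite size_polyXn /= -addnS leq_add2l.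
move=> i; rewrite /e'; split=> [j|k]; rewrite mxE.
  have [_|_] := eqVneq i i1; first exact: r1s.
  have [_|_] := eqVneq i i2; last by case: (LR i).
  rewrite prednK; last by lia.
  apply: size_cancel_top.
    apply: leq_trans (size_polyD _ _) _; rewrite geq_max size_polyN.
    rewrite (LR i2).1 /=; apply: leq_trans (Ys _ _ (r1s j)) _; lia.
  rewrite coefB /Y -mulrA coefCM coefXnM (_ : (_ < _)%N = false); last by lia.
  rewrite (_ : (e i2 - (e i2 - (e i1).+1) = (e i1).+1)%N); last by lia.
  rewrite /r1 coefD [(Rm i1 j)`__]nth_default ?add0r; last by case: (LR i1) => /(_ j).
  by rewrite -mulrA coefCM coefXnM ltnn subnn coefC eqxx mulrA mulVf // mul1r subrr.
have [_|_] := eqVneq i i1.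
  rewrite subnS prednK; last by lia.
  apply: size_cancel_top.
    apply: leq_trans (size_polyD _ _) _; rewrite geq_max.
    rewrite (LR i1).2 /=; apply: leq_trans (Ys _ _ (l2s k)) _; lia.
  rewrite coefD /Y -mulrA coefCM coefXnM (_ : (_ < _)%N = false); last by lia.
  rewrite (_ : (d - e i1 - (e i2 - (e i1).+1) = (d - e i2).+1)%N); last by lia.
  rewrite /l2 coefB [(L k i2)`__]nth_default ?sub0r; last by case: (LR i2) => _ /(_ k).
  by rewrite -mulrA coefCM coefXnM ltnn subnn coefC eqxx mulrN mulrA mulVf // mul1r subrr.
have [_|_] := eqVneq i i2; last by case: (LR i).
by apply: leq_trans (l2s k) _; lia.
Qed.

End ProfileShift.

(** * Closure and rebalancing of profiles *)

Section Closure.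
Variable R : realType.
Local Notation C := (R[i]).
Implicit Types m n r d : nat.

Definition sqdist m n d (P Q : 'M[{poly C}]_(m, n)) : R :=
  \sum_(k < d.+1) \sum_(i < m) \sum_(j < n) sqmod ((P i j)`_k - (Q i j)`_k).

Lemma sqmod_ge0 (z : C) : 0 <= sqmod z.
Proof. by rewrite addr_ge0 ?sqr_ge0. Qed.

Lemma sqmodD (z w : C) : sqmod (z + w) <= 2 * sqmod z + 2 * sqmod w.
Proof.
case: z w => [a b] [a' b']; rewrite /sqmod /=.
have := sqr_ge0 (a - a'); have := sqr_ge0 (b - b'); nra.
Qed.

Lemma sqmod_real_scale (a : R) (z : C) : sqmod (a%:C%C * z) = a ^+ 2 * sqmod z.
Proof. case: z => x y; rewrite /sqmod /=; ring. Qed.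

Lemma sqdist_ge0 m n d (P Q : 'M[{poly C}]_(m, n)) : 0 <= sqdist d P Q.
Proof. by do 3!(apply: sumr_ge0 => ? _); exact: sqmod_ge0. Qed.

Lemma pdist_lt m n d (P Q : 'M[{poly C}]_(m, n)) (eps : R) :
  0 < eps -> (pdist d P Q < eps) = (sqdist d P Q < eps ^+ 2).
Proof.
move=> e0; rewrite /pdist -[X in _ < X](ger0_norm (ltW e0)) -sqrtr_sqr.
by rewrite ltr_sqrt // exprn_gt0.
Qed.

Lemma sqdistD m n d (P S Q : 'M[{poly C}]_(m, n)) :
  sqdist d P Q <= 2 * sqdist d P S + 2 * sqdist d S Q.
Proof.
rewrite /sqdist !mulr_sumr -big_split; apply: ler_sum => k _ /=.
rewrite !mulr_sumr -big_split; apply: ler_sum => i _ /=.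
rewrite !mulr_sumr -big_split; apply: ler_sum => j _ /=.
by apply: le_trans (sqmodD _ _); rewrite subrKA.
Qed.

(** Approximations are chained, each within [eps / 2]. The weak triangle inequality [sqdistD]
    suffices, since [2 (eps/2)^2 + 2 (eps/2)^2 = eps^2]. *)
Lemma pclosure_mono m n d (S T : 'M[{poly C}]_(m, n) -> Prop) P :
  (forall Q, S Q -> pclosure R m n d T Q) ->
  pclosure R m n d S P -> pclosure R m n d T P.
Proof.
move=> ST [dP clP]; split=> // eps e0.
have e2 : 0 < eps / 2 by rewrite divr_gt0.
have [Q [SQ PQ]] := clP _ e2; have [_ clQ] := ST Q SQ.
have [Q' [TQ' QQ']] := clQ _ e2; exists Q'; split=> //.
move: PQ QQ'; rewrite !pdist_lt // => PQ QQ'.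
apply: le_lt_trans (sqdistD d P Q Q') _; nra.
Qed.

Lemma pclosure_line m n d (S : 'M[{poly C}]_(m, n) -> Prop) P Z :
  deg_le d P -> (forall dl : C, dl != 0 -> S (P + dl%:P *: Z)) ->
  pclosure R m n d S P.
Proof.
move=> dP SP; split=> // eps e0; pose K := sqdist d 0 Z.
have K0 : 0 <= K by exact: sqdist_ge0.
have K1 : 0 < K + 1 by rewrite ltr_wpDl.
(* The squared distance is [dl ^+ 2 * K], and [K < (K + 1)^2] holds even when [K = 0]. *)
pose dl := eps / (K + 1).
have dl0 : 0 < dl by rewrite divr_gt0.
exists (P + (dl%:C%C)%:P *: Z); split.
  by apply: SP; rewrite eq_complex /= eqxx andbT gt_eqF.
rewrite pdist_lt //.
have -> : sqdist d P (P + (dl%:C%C)%:P *: Z) = dl ^+ 2 * K.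
  rewrite /K /sqdist !mulr_sumr; apply: eq_bigr => k _.
  rewrite !mulr_sumr; apply: eq_bigr => i _; rewrite !mulr_sumr; apply: eq_bigr => j _.
  rewrite !mxE coefD coefCM coef0 -sqmod_real_scale; congr sqmod; ring.
rewrite /dl expr_div_n mulrAC ltr_pdivrMr ?exprn_gt0 // ltr_pM2l ?exprn_gt0 //.
nra.
Qed.

Lemma pclosure_sub m n d (S : 'M[{poly C}]_(m, n) -> Prop) P :
  deg_le d P -> S P -> pclosure R m n d S P.
Proof. by move=> dP SP; apply: (pclosure_line (Z := 0)) => // dl _; rewrite scaler0 addr0. Qed.

Lemma profile_factor_rebalance m n r d a (e : 'I_r -> nat) (P : 'M[{poly C}]_(m, n)) :
  (0 < r)%N -> (\sum_i e i = a)%N -> (forall i, (e i <= d)%N) -> profile_factor d e P ->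
  pclosure R m n d (profile_factor d (fun i : 'I_r => a %/ r + (i < a %% r))%N) P.
Proof.
move=> r0; set f := fun i : 'I_r => _.
have sf : (\sum_i f i = a)%N.
  rewrite /f big_split /= sum_nat_const card_ord mulnC [RHS](divn_eq a r); congr (_ + _)%N.
  have ar : (a %% r <= r)%N by rewrite ltnW ?ltn_mod.
  rewrite (eq_bigr (fun i : 'I_r => if (i < a %% r)%N then 1%N else 0%N)) => [|i _]; last by case: ifP.
  by rewrite -big_mkcond -(big_ord_widen _ (fun=> 1%N)) // sum1_card card_ord.
have lt_sum (g h : 'I_r -> nat) i : (g i < h i)%N -> (forall j, (g j <= h j)%N) ->
    (\sum_j g j < \sum_j h j)%N.
  move=> ghi gh; rewrite (bigD1 i) //= [X in (_ < X)%N](bigD1 i) //= -addSn leq_add //.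
  exact: leq_sum.
(* With truncated subtraction this sum is the total deficit of [e] below the balanced profile; a
   shift lowers it because it fills a deficit at [i1] and only removes an excess at [i2]. *)
have [N] := ubnP (\sum_i (f i - e i))%N.
elim: N => // N IH in e P *; rewrite ltnS => eN se ed pP.
have dP : deg_le d P by exact: profile_factor_size pP.
have [i1 fi1|fe] := pickP (fun i => e i < f i)%N; last first.
  have fe' j : (f j <= e j)%N by rewrite leqNgt fe.
  have ef : e =1 f.
    move=> i; apply/eqP; rewrite eqn_leq fe' andbT leqNgt; apply: contra_eqN se => ie.
    by rewrite neq_ltn -sf (lt_sum _ _ i ie fe') orbT.
  by apply: pclosure_sub => //; exact: profile_factor_eq pP.
have [i2 fi2|ef] := pickP (fun i => f i < e i)%N; last first.
  have /(lt_sum e f i1 fi1) : forall j, (e j <= f j)%N by move=> j; rewrite leqNgt ef.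
  by rewrite se sf ltnn.
(* The values of [f] differ by at most one, so [e i1 < f i1 <= f i2 + 1 <= e i2]. *)
have e12 : (e i1 < e i2)%N.
  move: fi1 fi2; rewrite /f; case: (i1 < _)%N; case: (i2 < _)%N => /=;
    move: (a %/ r)%N (e i1) (e i2) => q x y; lia.
have i12 : i2 != i1 by apply: contraTneq e12 => ->; rewrite ltnn.
have e12d : (e i1 < e i2 <= d)%N by rewrite e12 ed.
have [Z pZ] := profile_shift e12d pP.
apply: (@pclosure_mono _ _ _ _ _ P _ (pclosure_line dP pZ)) => Q pQ.
apply: IH pQ.
- apply: leq_trans eN; apply: (lt_sum _ _ i1) => [|j].
    by rewrite eqxx subnS prednK // subn_gt0.
  case: eqP => [->|_]; first by rewrite leq_sub2l.
  by case: eqP => [->|//]; move: fi2; lia.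
- rewrite -se (bigD1 i1) // (bigD1 i2) //= [in RHS](bigD1 i1) // [in RHS](bigD1 i2) //=.
  rewrite eqxx (negPf i12) eqxx !addnA; congr (_ + _)%N; first by move: e12; lia.
  by apply: eq_bigr => i /andP[/negPf -> /negPf ->].
- move=> i; case: eqP => [_|_]; first exact: leq_trans e12 (ed i2).
  by case: eqP => // _; apply: leq_trans (leq_pred _) (ed i2).
Qed.

End Closure.

(** * Making the degrees exact *)

Section ExactDegrees.
Variable R : realType.
Local Notation C := (R[i]).
Implicit Types m n r d : nat.

(** A row that already has the exact size is left alone. In any other row all entries have degree
    below [e i], so adding a nonzero multiple of ['X^(e i)] cannot cancel. *)
Lemma row_size_perturb m n (e : 'I_m -> nat) (M : 'M[{poly C}]_(m, n)) :
  (0 < n)%N -> (forall i j, (size (M i j) <= (e i).+1)%N) ->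
  exists E : 'M[{poly C}]_(m, n), forall (dl : C) i, dl != 0 ->
    row_size (M + dl%:P *: E) i = (e i).+1.
Proof.
move=> n0 Me.
pose E : 'M[{poly C}]_(m, n) := \matrix_(i, j) if row_size M i == (e i).+1 then 0 else 'X^(e i).
exists E => dl i dl0; have [eqi|neqi] := eqVneq (row_size M i) (e i).+1.
  by rewrite -[RHS]eqi; apply: eq_bigr => j _; rewrite !mxE eqi eqxx mulr0 addr0.
have Mi j : (size (M i j) <= e i)%N.
  have sj : (size (M i j) <= row_size M i)%N by exact: leq_bigmax.
  rewrite -ltnS; apply: leq_ltn_trans sj _; rewrite ltn_neqAle neqi.
  by apply/bigmax_leqP => k _; exact: Me.
have szi j : size ((M + dl%:P *: E) i j) = (e i).+1.
  rewrite !mxE (negPf neqi) addrC size_polyDl mul_polyC size_scale // size_polyXn //.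
  by rewrite ltnS.
rewrite /row_size (eq_bigr (fun=> (e i).+1)) => [|j _]; last exact: szi.
apply/eqP; rewrite eqn_leq; apply/andP; split; first exact/bigmax_leqP.
exact: (leq_bigmax (Ordinal n0)).
Qed.

Definition exact_profile_factor m n r d (e : 'I_r -> nat) (P : 'M[{poly C}]_(m, n)) :=
  exists (L : 'M_(m, r)) (Rm : 'M_(r, n)), P = L *m Rm /\
    forall i, row_size Rm i = (e i).+1 /\ col_size L i = (d - e i).+1.

Lemma profile_factor_exact_closure m n r d (e : 'I_r -> nat) (P : 'M[{poly C}]_(m, n)) :
  (0 < m)%N -> (0 < n)%N -> (forall i, (e i <= d)%N) ->
  profile_factor d e P -> pclosure R m n d (exact_profile_factor d e) P.
Proof.
move=> m0 n0 ed pP; have [L [Rm [eP LR]]] := pP.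
have dle Q : profile_factor d e Q -> deg_le d Q by exact: profile_factor_size.
(* Intermediate set: exact rows, bounded columns. Perturbing one factor at a time keeps the product
   affine in [dl], as [pclosure_line] requires. *)
pose S (Q : 'M[{poly C}]_(m, n)) := exists (L : 'M_(m, r)) (Rm : 'M_(r, n)), Q = L *m Rm /\
    forall i, row_size Rm i = (e i).+1 /\ forall k, (size (L k i) <= (d - e i).+1)%N.
have Sp Q : S Q -> profile_factor d e Q.
  move=> [L' [R' [eQ LR']]]; exists L', R'; split=> // i; split=> [j|]; last by case: (LR' i).
  by rewrite -(LR' i).1; exact: leq_bigmax.
apply: (@pclosure_mono _ _ _ _ S) => [Q SQ|].
  have [L' [R' [eQ LR']]] := SQ.
  have [k i|E EP] := @row_size_perturb r m (fun i => d - e i)%N L'^T m0.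
    by rewrite mxE; case: (LR' k).
  apply: (@pclosure_line _ _ _ _ _ _ (E^T *m R')) => [|dl dl0]; first exact/dle/Sp.
  exists (L' + dl%:P *: E^T), R'; split=> [|i].
    by rewrite mulmxDl -scalemxAl eQ.
  split; first by case: (LR' i).
  by rewrite -(EP dl i dl0); apply: eq_bigr => k _; rewrite !mxE.
have [i j|E EP] := @row_size_perturb r n e Rm n0; first by case: (LR i).
apply: (@pclosure_line _ _ _ _ _ _ (L *m E)) => [|dl dl0]; first exact/dle.
exists L, (Rm + dl%:P *: E); split=> [|i].
  by rewrite mulmxDr -scalemxAr eP.
by split=> [|k]; [exact: EP|case: (LR i)].
Qed.

End ExactDegrees.

(** * Normal rank under limits *)

Lemma exists_nonroot (F : numFieldType) (p : {poly F}) : p != 0 -> exists x, p.[x] != 0.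
Proof.
move=> p0; pose s := [seq k%:R | k <- iota 0 (size p)] : seq F.
have su : uniq s by rewrite map_inj_uniq ?iota_uniq // => a b /eqP; rewrite eqr_nat => /eqP.
have /allPn[x _ px] : ~~ all (root p) s.
  apply/negP => /(max_poly_roots p0)/(_ su).
  by rewrite size_map size_iota ltnn.
by exists x.
Qed.

(** Such [U] and [V] exist over the fraction field. Clearing denominators leaves a scalar matrix
    [c * b], and [x] is any point where this polynomial does not vanish. *)
Lemma normal_rank_specialize (F : numFieldType) m n s (P : 'M[{poly F}]_(m, n)) :
  (s <= \rank (map_mx (@FracField.tofrac {poly F}) P))%N ->
  exists x (U : 'M_(s, m)) (V : 'M_(n, s)), U *m map_mx (horner^~ x) P *m V = 1%:M.
Proof.
set M := map_mx _ P => sM.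
pose U : 'M_(s, m) := pid_mx s *m invmx (col_ebase M).
pose V : 'M_(n, s) := invmx (row_ebase M) *m pid_mx s.
have UV : U *m M *m V = 1%:M.
  rewrite -[X in _ *m X *m _](mulmx_ebase M) /U /V !mulmxA.
  rewrite mulmxKV ?col_ebase_unit // mulmxK ?row_ebase_unit //.
  rewrite !mul_pid_mx -pid_mx_1; congr pid_mx.
  have := rank_leq_row M; have := rank_leq_col M; lia.
have [c c0 [U' eU]] := mx_clear_denominators U.
have [b b0 [V' eV]] := mx_clear_denominators V.
have [x cbx] := exists_nonroot (mulf_neq0 c0 b0).
have e : U' *m P *m V' = (c * b)%:M.
  suff: map_mx (@FracField.tofrac {poly F}) (U' *m P *m V') =
        map_mx (@FracField.tofrac {poly F}) (c * b)%:M.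
    move/matrixP=> h; apply/matrixP=> i j; apply/eqP.
    by rewrite -tofrac_eq; move: (h i j); rewrite !mxE => ->.
  rewrite !map_mxM /= -eU -eV -/M -!scalemxAl -scalemxAr scalerA UV.
  by rewrite map_scalar_mx /= tofracM scalemx1.
exists x, ((c * b).[x]^-1 *: map_mx (horner^~ x) U'), (map_mx (horner^~ x) V').
rewrite -!scalemxAl -!(map_mxM (horner_eval x)) e.
have -> : map_mx (horner_eval x) (c * b)%:M = ((c * b).[x])%:M :> 'M_s.
  by rewrite map_scalar_mx.
by rewrite scale_scalar_mx mulVf.
Qed.

(** If [v *m N = 0], the sum [S] of the absolute values of [v] satisfies [S <= k q S] with
    [k q < 1], which forces [S = 0]. *)
Lemma near_identity_rank (F : numFieldType) k (N : 'M[F]_k) (q : F) :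
  (forall i j, `|N i j - (i == j)%:R| <= q) -> k%:R * q < 1 -> \rank N = k.
Proof.
move=> Nq q1; apply/eqP; rewrite -/(row_free N) -kermx_eq0; apply/rowV0P => v /sub_kermxP vN.
have vE j : v 0 j = - \sum_i v 0 i * (N i j - (i == j)%:R).
  have /matrixP/(_ 0 j) := vN; rewrite !mxE => e.
  rewrite (eq_bigr (fun i => v 0 i * N i j - v 0 i * (i == j)%:R)); last first.
    by move=> i _; rewrite mulrBr.
  rewrite sumrB e sub0r opprK (bigD1 j) //= eqxx mulr1 big1 ?addr0 // => i /negPf ->.
  by rewrite mulr0.
pose S := \sum_j `|v 0 j|.
have S0 : 0 <= S by exact: sumr_ge0.
have : S <= k%:R * q * S.
  rewrite {1}/S; apply: (@le_trans _ _ (\sum_(j < k) \sum_i q * `|v 0 i|)).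
    apply: ler_sum => j _; rewrite {1}vE normrN; apply: le_trans (ler_norm_sum _ _ _) _.
    by apply: ler_sum => i _; rewrite normrM mulrC ler_wpM2r.
  by rewrite sumr_const card_ord -mulr_sumr -[leLHS]mulr_natl mulrA.
have [Sz _|Sn] := eqVneq S 0; last first.
  have Sp : 0 < S by rewrite lt_def Sn.
  by rewrite -[X in X <= _]mul1r ler_pM2r // => /(lt_le_trans q1); rewrite ltxx.
apply/rowP=> j; rewrite mxE; apply/eqP; rewrite -normr_eq0.
by move/eqP: Sz; rewrite psumr_eq0 // => /allP/(_ j); rewrite mem_index_enum => /(_ isT).
Qed.

Lemma norm_horner_le (F : numFieldType) (p : {poly F}) d x (eps : F) :
  (size p <= d.+1)%N -> (forall k, (k < d.+1)%N -> `|p`_k| <= eps) ->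
  `|p.[x]| <= eps * \sum_(k < d.+1) `|x| ^+ k.
Proof.
move=> sp pe; rewrite (horner_coef_wide _ sp) mulr_sumr.
apply: le_trans (ler_norm_sum _ _ _) _; apply: ler_sum => k _.
by rewrite normrM normrX ler_wpM2r ?exprn_ge0 ?pe.
Qed.

Section RankClosed.
Variable R : realType.
Local Notation C := (R[i]).
Implicit Types m n r d : nat.

Lemma coef_pdist m n d (P Q : 'M[{poly C}]_(m, n)) (eps : R) i j k :
  0 < eps -> (k < d.+1)%N -> pdist d P Q < eps -> `|(P i j)`_k - (Q i j)`_k| <= eps%:C%C.
Proof.
move=> e0 kd; rewrite pdist_lt // => PQ.
rewrite normc_def lecR -[leRHS](ger0_norm (ltW e0)) -sqrtr_sqr; apply: ler_wsqrtr.
rewrite -/(sqmod _); apply: le_trans (ltW PQ); rewrite /sqdist.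
rewrite (bigD1 (Ordinal kd)) //= (bigD1 i) //= (bigD1 j) //=.
rewrite -2!addrA lerDl; do 2?(apply: addr_ge0); do 3?(apply: sumr_ge0 => ? _); exact: sqmod_ge0.
Qed.

Lemma pclosure_normal_rank m n r d (S : 'M[{poly C}]_(m, n) -> Prop) P :
  (forall Q, S Q -> deg_le d Q /\
     exists (L : 'M_(m, r)) (Rm : 'M_(r, n)), Q = L *m Rm) ->
  pclosure R m n d S P -> (normal_rank P <= r)%N.
Proof.
move=> SP [dP clP]; rewrite leqNgt; apply/negP => /normal_rank_specialize [x [U [V UPV]]].
pose g := \sum_(k < d.+1) `|x| ^+ k.
(* Summing over all [i] and [j] gives one constant valid for every entry: the entries of [N - 1] are
   at most [eps * B]. The choice of [eps] below makes [r.+1 * eps * B < 1]. *)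
pose B := \sum_i \sum_j \sum_a \sum_b `|U i b| * g * `|V a j|.
have g0 : 0 <= g by apply: sumr_ge0 => k _; rewrite exprn_ge0.
have B0 : 0 <= B by do 4!(apply: sumr_ge0 => ? _); rewrite !mulr_ge0.
have [b b0 Bb] : exists2 b : R, 0 <= b & B = b%:C%C.
  move: B0; case: (B) => br bi; rewrite lecE /= => /andP[/eqP -> br0]; by exists br.
pose eps : R := (r.+1%:R * b + 1)^-1.
have D0 : 0 < r.+1%:R * b + 1 by rewrite ltr_wpDl // mulr_ge0.
have e0 : 0 < eps by rewrite invr_gt0.
have [Q [SQ PQ]] := clP _ e0; have [dQ [L [Rm eQ]]] := SP Q SQ.
pose N := U *m map_mx (horner^~ x) Q *m V.
have Nr : (\rank N <= r)%N.
  rewrite /N eQ (map_mxM (horner_eval x)) /= mulmxA -(mulmxA _ _ V).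
  exact: mulmx_max_rank.
suff Nk : \rank N = r.+1 by rewrite Nk ltnn in Nr.
apply: (@near_identity_rank _ _ _ (eps%:C%C * B)) => [i j|]; last first.
  rewrite Bb (_ : r.+1%:R * _ = (r.+1%:R * (eps * b))%:C%C); last first.
    by rewrite !rmorphM /= rmorph_nat.
  rewrite -[X in _ < X]/(1%:C%C : C) ltcR mulrCA mulrC ltr_pdivrMr // mul1r ltrDl.
  exact: ltr01.
have -> : N i j - (i == j)%:R = \sum_a \sum_b U i b * ((Q b a).[x] - (P b a).[x]) * V a j.
  have -> : (i == j)%:R = (U *m map_mx (horner^~ x) P *m V) i j by rewrite UPV mxE.
  rewrite !mxE -sumrB; apply: eq_bigr => a _; rewrite !mxE -mulrBl -sumrB mulr_suml.
  by apply: eq_bigr => c _; rewrite !mxE -mulrBr.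
apply: le_trans (ler_norm_sum _ _ _) _.
apply: (@le_trans _ _ (eps%:C%C * \sum_a \sum_b `|U i b| * g * `|V a j|)).
  rewrite mulr_sumr; apply: ler_sum => a _; apply: le_trans (ler_norm_sum _ _ _) _.
  rewrite mulr_sumr; apply: ler_sum => c _; rewrite !normrM mulrA ler_wpM2r //.
  rewrite mulrCA ler_wpM2l // -hornerN -hornerD; apply: norm_horner_le => [|k kd].
    by rewrite (leq_trans (size_polyD _ _)) // size_polyN geq_max dQ dP.
  by rewrite coefB distrC; apply: coef_pdist PQ.
have /ler_wpM2l : 0 <= eps%:C%C by rewrite lecR ltW.
apply; rewrite /B (bigD1 i) //= (bigD1 j) //= -addrA lerDl.
apply: addr_ge0; do 4?(apply: sumr_ge0 => ? _); rewrite ?mulr_ge0 //.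
Qed.

End RankClosed.

(** * The balanced profile and the sets [Bset] and [Cset] *)

Section BalancedProfile.
Context (R : realType) (m n r d a : nat) (r0 : (0 < r)%N) (ad : (a <= r * d)%N).
Local Notation C := (R[i]).

Definition balanced_profile (i : 'I_r) : nat := (a %/ r + (i < a %% r))%N.

Lemma balanced_profile_le i : (balanced_profile i <= d)%N.
Proof.
rewrite /balanced_profile; case: ltnP => [it|_].
  (* An index below [a %% r] excludes [a = r * d], so [a %/ r < d] leaves room for the extra
     unit. *)
  by rewrite addn1 ltn_divLR // mulnC ltn_neqAle ad andbT; apply: contraTneq it => ->; rewrite modnMr.
by rewrite addn0 -(mulKn d r0) leq_div2r.
Qed.

(** For [i < a %% r] the column bounds [d - a %/ r] and [(d - (a %/ r).+1).+1] agree only because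
    [a %/ r < d], which [balanced_profile_le] provides. *)
Lemma Cset_profile_factor (P : 'M[{poly C}]_(m, n)) :
  Cset R m n r d a P <-> profile_factor d balanced_profile P.
Proof.
have degE (i : 'I_r) (L : 'M[{poly C}]_(m, r)) (Rm : 'M[{poly C}]_(r, n)) k l :
    (row_size Rm i <= k)%N /\ (col_size L i <= l)%N <->
    (forall j, (size (Rm i j) <= k)%N) /\ (forall j, (size (L j i) <= l)%N).
  split=> -[hR hL]; split.
  - by move=> j; apply: leq_trans hR; exact: leq_bigmax.
  - by move=> j; apply: leq_trans hL; exact: (leq_bigmax (F := fun j => size (L j i))).
  - by apply/bigmax_leqP => j _; exact: hR.
  - by apply/bigmax_leqP => j _; exact: hL.
by split=> -[L [Rm [eP LR]]]; exists L, Rm; split=> // i;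
  move: (LR i) (balanced_profile_le i); rewrite /balanced_profile;
  case: ltnP => _; rewrite ?addn1 ?addn0 // => LRi ad'; apply/degE; apply/degE;
  move: LRi; rewrite ?subnS ?prednK ?subn_gt0 // => /degE.
Qed.

Lemma exact_profile_factor_Bset (P : 'M[{poly C}]_(m, n)) :
  exact_profile_factor d balanced_profile P -> Bset R m n r d a P.
Proof.
move=> [L [Rm [eP LR]]]; exists L, Rm; split=> // i; move: (LR i) (balanced_profile_le i).
rewrite /balanced_profile; case: ltnP => _; rewrite ?addn1 ?addn0 // => -[-> ->] ad'.
by split=> //; rewrite subnS prednK // subn_gt0.
Qed.

Lemma Bset_Cset (P : 'M[{poly C}]_(m, n)) : Bset R m n r d a P -> Cset R m n r d a P.
Proof.
move=> [L [Rm [eP LR]]]; exists L, Rm; split=> // i.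
by move: (LR i); case: ifP => _ [-> ->].
Qed.

End BalancedProfile.

Unset Implicit Arguments.

Theorem theorem4p13 (R : realType) (m n r d : nat) :
  (2 <= m)%N -> (2 <= n)%N -> (1 <= d)%N -> (0 < r)%N -> (r < minn m n)%N ->
  (* (i) *)
  (forall a : nat, (a <= r * d)%N ->
     forall P : 'M[{poly R[i]}]_(m, n), Bset R m n r d a P -> Cset R m n r d a P) /\
  (* (ii) *)
  (forall a : nat, (a <= r * d)%N ->
     forall P : 'M[{poly R[i]}]_(m, n),
       pclosure R m n d (Bset R m n r d a) P <-> pclosure R m n d (Cset R m n r d a) P) /\
  (* (iii) *)
  (forall P : 'M[{poly R[i]}]_(m, n),
     Cdr R m n d r P <-> exists a : nat, (a <= r * d)%N /\ pclosure R m n d (Cset R m n r d a) P) /\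
  (* (iv) *)
  (forall P : 'M[{poly R[i]}]_(m, n),
     Cdr R m n d r P -> exists a : nat, pclosure R m n d (Cset R m n r d a) P).
Proof.
move=> m2 n2 d1 r0 rmn.
have Cdeg a P : (a <= r * d)%N -> Cset R m n r d a P -> deg_le d P.
  move=> ad /(Cset_profile_factor r0 ad) pP.
  exact: (profile_factor_size (balanced_profile_le r0 ad)) pP.
have CdrC P : Cdr R m n d r P ->
    exists a : nat, (a <= r * d)%N /\ pclosure R m n d (Cset R m n r d a) P.
  move=> [dP /normal_rank_factor [c c0 [A [B cP]]]].
  have [L [Rm eP]] := cancel_factor c0 cP.
  have [e [ed pP]] := exists_degree_profile eP dP.
  have ad : (\sum_i e i <= r * d)%N.
    by rewrite -[r in (_ <= r * _)%N]card_ord -sum_nat_const leq_sum.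
  (* The index [a] is the total row degree of the profile, which rebalancing preserves. *)
  exists (\sum_i e i)%N; split=> //.
  have := profile_factor_rebalance r0 erefl ed pP.
  by apply: pclosure_mono => Q pQ; apply: pclosure_sub;
    [exact: profile_factor_size (balanced_profile_le r0 ad) pQ|exact/Cset_profile_factor].
split; [by move=> a _ P; exact: Bset_Cset|split; [move=> a ad P; split|split]].
- apply: pclosure_mono => Q /Bset_Cset CQ.
  by apply: pclosure_sub => //; exact: Cdeg CQ.
- apply: pclosure_mono => Q /(Cset_profile_factor r0 ad).
  have bd := balanced_profile_le r0 ad.
  move/(profile_factor_exact_closure (ltnW m2) (ltnW n2) bd).
  apply: pclosure_mono => Q' eQ'.
  have BQ' : Bset R m n r d a Q' by exact: exact_profile_factor_Bset.
  by apply: pclosure_sub => //; exact: Cdeg (Bset_Cset BQ').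
- move=> P; split=> [/CdrC //|[a [ad clP]]]; split; first by case: clP.
  apply: pclosure_normal_rank clP => Q CQ; split; first exact: Cdeg CQ.
  by case: CQ => L [Rm [eQ _]]; exists L, Rm.
- by move=> P /CdrC [a [_ ?]]; exists a.
Qed.
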